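(* Let $n$ be a power of $2$, $d$ a positive integer, and $\varepsilon$ a power of $1/2$ with $\varepsilon\le 1/2$ and $\log_2(1/\varepsilon)\le d\log_2 n$. Any $(t,\varepsilon/2,1/16)$-monotonicity tester for functions $f:[n]^d\to\mathbb{N}$ must have $t\ge \frac{d\log_2 n-\log_2(1/\varepsilon)}{8\varepsilon}$.
   Context: $[n]^d$ carries the coordinate-wise partial order $\preceq$. A function $f:[n]^d\to\mathbb{N}$ is monotone if $f(x)\le f(y)$ whenever $x\preceq y$; it is $\varepsilon$-far from monotone if at least an $\varepsilon$ fraction of its values must be changed to make it monotone. A $(t,\varepsilon,\delta)$-monotonicity tester is a (possibly adaptive, randomized) algorithm that, for any $f:[n]^d\to\mathbb{N}$, makes at most $t$ queries to $f$ and outputs accept or reject, such that if $f$ is monotone it accepts with probability $>1-\delta$, and if $f$ is $\varepsilon$-far from monotone it rejects with probability $>1-\delta$. *)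

(* Defs.v *)
(* MathComp / MathComp-Analysis *)
From HB Require Import structures.
From mathcomp Require Import all_boot all_order all_algebra.
From mathcomp Require Import all_classical all_reals all_analysis.

Set Implicit Arguments.
Unset Strict Implicit.
Unset Printing Implicit Defensive.

Import Order.TTheory GRing.Theory Num.Theory.

Local Open Scope classical_set_scope.
Local Open Scope ring_scope.

Definition log2 {R : realType} (x : R) : R := ln x / ln 2.

(* The hypergrid [n]^d, with coordinates 0, ..., n-1 instead of 1, ..., n.
   The canonical order of [d.-tupleprod 'I_n] is coordinate-wise. *)
Definition grid (n d : nat) := (d.-tupleprod 'I_n)%type.

Definition monotone n d (f : grid n d -> nat) : Prop :=
  forall x y : grid n d, (x <= y)%O -> (f x <= f y)%N.

Definition far_from_monotone {R : realType} n d (eps : R)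
    (f : grid n d -> nat) : Prop :=
  forall g : grid n d -> nat, monotone g ->
    eps * #|{: grid n d}|%:R <= #|[set x : grid n d | f x != g x]%SET|%:R.

(* A deterministic adaptive algorithm with query access to a function X -> nat:
   it either halts with a verdict (true = accept) or queries a point and
   continues according to the value received. *)
Inductive query_algo (X : Type) : Type :=
  | Halt (accept : bool)
  | Query (x : X) (next : nat -> query_algo X).
Arguments Halt {X} accept.
Arguments Query {X} x next.

Fixpoint accepts (X : Type) (a : query_algo X) (f : X -> nat) : bool :=
  match a with
  | Halt b => b
  | Query x next => accepts (next (f x)) f
  end.

Fixpoint num_queries (X : Type) (a : query_algo X) (f : X -> nat) : nat :=
  match a with
  | Halt _ => 0
  | Query x next => (num_queries (next (f x)) f).+1
  end.

(* A randomized algorithm is a random deterministic one: [A w] is the algorithm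
   that is run when the coin tosses are [w].  Measurability is only required of
   the events "A accepts f", whose probabilities have to make sense. *)
Definition monotonicity_tester {R : realType} {disp : measure_display}
    {Omega : measurableType disp} (P : probability Omega R) n d
    (t : nat) (eps delta : R) (A : Omega -> query_algo (grid n d)) : Prop :=
  forall f : grid n d -> nat,
    [/\ measurable [set w | accepts (A w) f],
        forall w, (num_queries (A w) f <= t)%N,
        monotone f ->
          ((1 - delta)%:E < P [set w | accepts (A w) f])%E &
        far_from_monotone eps f ->
          ((1 - delta)%:E < P [set w | ~~ accepts (A w) f])%E].

(* Main.v *)
(* Order the grid linearly by reading the coordinates of a point as digits in base n = 2 ^ k; this rank is monotone. Cut the ranks into 1/eps blocks of size 2 ^ m. Flipping bit b < m of the rank inside one block B gives a function that is eps/2-far from monotone, because flipping a bit moves a point to a comparable one. It is order-isomorphic to the rank on every query set T in which no two points of block B have b as the highest bit where their ranks differ, and T fails this condition for at most #|T| of the m / eps pairs (B, b).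
   To hide everything but the order of the answers, the values are passed through a random increasing map phi: nat -> nat whose values at any t indices have almost the same joint law whatever the indices are. This replaces the usual Ramsey argument and makes the bound hold for each deterministic algorithm separately, so that only the measurability of the acceptance events is needed to average over the coins of the tester. *)
Require Import Defs.
From HB Require Import structures.
From mathcomp Require Import all_boot all_order all_algebra.
From mathcomp Require Import all_classical all_reals all_analysis.
From mathcomp Require Import measurable_realfun.
From mathcomp Require Import zify lra.

Import Order.TTheory GRing.Theory Num.Theory.

(** * Increasing maps whose values hide their arguments *)

(** Two windows of length [B] whose starts differ by [c] have at most [c] positions each outside the
    other. This measures how little a uniform step notices a shift. *)
Lemma sum_shift_le (B c : nat) (g : nat -> bool) :
  \sum_(i < B) g i <= \sum_(i < B) g (c + i) + c /\
  \sum_(i < B) g (c + i) <= \sum_(i < B) g i + c.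
Proof.
have le_c m : \sum_(m <= i < m + c) g i <= c.
  rewrite -[leqRHS](addKn m) -[leqRHS]muln1 -sum_nat_const_nat leq_sum // => i _.
  by case: (g i).
have shift : \sum_(i < B) g (c + i) = \sum_(0 + c <= i < c + B) g i.
  rewrite big_addn addKn big_mkord.
  by apply: eq_bigr => i _; rewrite addnC.
have e1 : \sum_(0 <= i < c + B) g i =
    \sum_(0 <= i < 0 + c) g i + \sum_(0 + c <= i < c + B) g i.
  by rewrite -big_cat_nat //= leq_addr.
have e2 : \sum_(0 <= i < c + B) g i =
    \sum_(0 <= i < B) g i + \sum_(B <= i < B + c) g i.
  by rewrite [c + B]addnC -big_cat_nat //= leq_addr.
rewrite shift -(big_mkord xpredT (fun i => nat_of_bool (g i))).
by have := le_c 0; have := le_c B; lia.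
Qed.

Lemma leq_mul_sum {I : finType} {L c : nat} {F G : I -> nat} :
  (forall i, L * F i <= L * G i + c) ->
  L * \sum_i F i <= L * \sum_i G i + #|I| * c.
Proof.
move=> le_FG; rewrite !big_distrr /= -sum_nat_const -big_split /=.
by apply: leq_sum => i _; apply: le_FG.
Qed.

Definition prepend (u : nat) (psi : nat -> nat) (i : nat) : nat :=
  if i is i'.+1 then u.+1 + psi i' else u.+1.

(** [psi] below the index [k] together with one value [v], packed as a single function so that one
    predicate can test both jointly. *)
Definition freeze (psi : nat -> nat) (k v i : nat) : nat :=
  if i < k then psi i else v.

Lemma freeze_prepend (u : nat) (psi : nat -> nat) (k v : nat) :
  freeze (prepend u psi) k.+1 (u.+1 + v) =1 prepend u (freeze psi k v).
Proof. by case=> [|i] //=; rewrite /freeze ltnS /=; case: ifP. Qed.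

(* The random map psi is a sum of independent uniform steps, each on a much larger scale than all the later ones together: adding the later steps to the k-th one hardly changes its law. *)
Lemma frozen_last_close (K L : nat) :
  exists (I : finType) (psi : I -> nat -> nat), [/\ 0 < #|I|,
    forall i, {homo psi i : a b / a < b} /\ 0 < psi i 0 &
    forall k (h : (nat -> nat) -> bool), k <= K ->
      (forall f g, f =1 g -> h f = h g) ->
      L * \sum_i h (freeze (psi i) k (psi i k))
        <= L * \sum_i h (freeze (psi i) k (psi i K)) + #|I| /\
      L * \sum_i h (freeze (psi i) k (psi i K))
        <= L * \sum_i h (freeze (psi i) k (psi i k)) + #|I|].
Proof.
elim: K => [|K [I [psi [I_gt0 psi_incr psi_close]]]].
  exists unit, (fun _ => S); split=> [|i|k h]; [by rewrite card_unit | by split=> // a b |].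
  by rewrite leqn0 => /eqP ->; rewrite !leq_addr.
(* The new first step is uniform on [B] values, at least [L] times every [psi i K], so shifting it
   by [psi i K] changes a probability by at most [1 / L]. *)
pose B := (L * \max_i psi i K).+1.
have le_B i : L * psi i K <= B.
  by rewrite leqW // leq_mul2l (leq_bigmax i) orbT.
exists (I * 'I_B)%type, (fun iu : I * 'I_B => prepend iu.2 (psi iu.1)).
split=> [|[i u] /=|k h le_k h_ext].
- by rewrite card_prod card_ord muln_gt0 I_gt0.
- have [mono_i pos_i] := psi_incr i; split=> //.
  move=> [|a] [|b] //= lt_ab; last by rewrite ltn_add2l mono_i.
  rewrite -[X in X < _]addn0 ltn_add2l; case: b {lt_ab} => // b.
  exact: leq_ltn_trans (mono_i 0 b.+1 _).
rewrite card_prod card_ord.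
pose F (b : nat -> nat) i (u : 'I_B) :=
  nat_of_bool (h (freeze (prepend u (psi i)) k (prepend u (psi i) (b k)))).
rewrite -(pair_bigA _ (F id)) -(pair_bigA _ (F (fun=> K.+1))) {}/F.
case: k le_k => [|k] le_k /=.
  have widen a b c : L * c <= B -> a <= b + c -> L * a <= L * b + B.
    move=> le_cB le_abc; apply: leq_trans (leq_mul (leqnn L) le_abc) _.
    by rewrite mulnDr leq_add2l.
  pose g v := h (fun _ => v.+1).
  have E1 i (u : nat) : h (freeze (prepend u (psi i)) 0 u.+1) = g u by apply: h_ext.
  have E2 i (u : nat) : h (freeze (prepend u (psi i)) 0 (u.+1 + psi i K)) = g (psi i K + u).
    by apply: h_ext => x; rewrite /freeze /= addSn addnC.
  under eq_bigr do under eq_bigr do rewrite E1.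
  under [X in _ <= L * X + _ /\ L * X <= _]eq_bigr do under eq_bigr do rewrite E2.
  by split; apply: leq_mul_sum => i; have [le1 le2] := sum_shift_le B (psi i K) g;
    [exact: widen (le_B i) le1 | exact: widen (le_B i) le2].
pose g u f := h (prepend u f).
have E i (u : nat) v : h (freeze (prepend u (psi i)) k.+1 (u.+1 + v)) = g u (freeze (psi i) k v).
  by apply: h_ext; apply: freeze_prepend.
under eq_bigr do under eq_bigr do rewrite E.
under [X in _ <= L * X + _ /\ L * X <= _]eq_bigr do under eq_bigr do rewrite E.
have swap (F : I -> 'I_B -> nat) :
  \sum_i \sum_u F i u = \sum_u \sum_i F i u by apply: exchange_big.
have -> : #|I| * B = #|'I_B| * #|I| by rewrite card_ord mulnC.
rewrite !swap.
have g_ext u f f' : f =1 f' -> g u f = g u f'.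
  by move=> eq_f; apply: h_ext => -[|a] //=; rewrite eq_f.
by split; apply: leq_mul_sum => u; have [] := psi_close k (g u) le_k (g_ext u).
Qed.

Definition order_iso {X : finType} (Q : {set X}) (p q : X -> nat) : Prop :=
  {in Q &, forall x y, (p x < p y) = (q x < q y)}.

Definition local_on {X : finType} (Q : {set X}) (h : (X -> nat) -> bool) : Prop :=
  forall f g, {in Q, f =1 g} -> h f = h g.

(* For uniformly random i, an event about phi i on at most s points has probabilities that differ by at most 1 / L for two order-isomorphic choices of arguments. *)
Definition spread {I : finType} (phi : I -> nat -> nat) (s N L : nat) : Prop :=
  forall (X : finType) (Q : {set X}) (p q : X -> nat) (h : (X -> nat) -> bool),
    #|Q| <= s -> (forall x, p x < N) -> (forall x, q x < N) ->
    order_iso Q p q -> local_on Q h ->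
    L * \sum_i h (phi i \o p) <= L * \sum_i h (phi i \o q) + #|I|.

(* Induction on s: composing with a further random map psi replaces the largest value by psi K, which no longer depends on the index it came from, so that only the other s values matter. *)
Lemma spreadable_family (s N L : nat) :
  exists (I : finType) (phi : I -> nat -> nat), [/\ 0 < #|I|,
    forall i, {homo phi i : a b / a < b} &
    spread phi s N L].
Proof.
elim: s L => [|s IHs] L.
  exists unit, (fun _ => id); split=> [|i a b //|X Q p q h]; first by rewrite card_unit.
  rewrite leqn0 cards_eq0 => /eqP -> _ _ _ h_loc.
  suff -> : h (id \o p) = h (id \o q) by apply: leq_addr.
  by apply: h_loc => x; rewrite inE.
(* The error [1 / L] is shared by three replacements: freeze the largest value for [p], pass from
   [p] to [q] on the other points, unfreeze for [q]. *)
have [J [y [J_gt0 y_incr y_close]]] := IHs (3 * L).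
pose K := \max_j y j N.
have le_K j a : a < N -> y j a <= K.
  by move=> /y_incr/ltnW/leq_trans; apply; apply: leq_bigmax.
have [I [psi [I_gt0 psi_incr psi_close]]] := frozen_last_close K (3 * L).
exists (I * J)%type, (fun ij => psi ij.1 \o y ij.2); split=> [|[i j] a b lt_ab|].
- by rewrite card_prod muln_gt0 I_gt0.
- by apply: (psi_incr i).1; apply: y_incr.
move=> X Q p q h card_Q p_lt q_lt pq_iso h_loc.
have [Q0|[m0 m0Q]] := set_0Vmem Q.
  suff -> : \sum_ij h ((psi ij.1 \o y ij.2) \o p) = \sum_ij h ((psi ij.1 \o y ij.2) \o q).
    exact: leq_addr.
  by apply: eq_bigr => ij _; congr nat_of_bool; apply: h_loc => x; rewrite Q0 inE.
have [m mQ m_max] : exists2 m, m \in Q & forall x, x \in Q -> p x <= p m.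
  by case: (arg_maxnP p m0Q) => m mQ m_max; exists m.
pose Q' := [set x in Q | p x < p m].
pose H i f := h (fun x => if x \in Q' then psi i (f x) else psi i K).
have H_loc i : local_on Q' (H i).
  by move=> f g eq_fg; apply: h_loc => x _ /=; case: ifP => // /eq_fg ->.
have card_Q' : #|Q'| <= s.
  rewrite -ltnS; apply: leq_trans card_Q; apply: proper_card.
  apply/properP; split; first by apply/fintype.subsetP => x; rewrite inE => /andP[].
  by exists m; rewrite // inE ltnn andbF.
have sum_close (r : X -> nat) : (forall x, r x < N) ->
    {in Q, forall x, (r x < r m) = (p x < p m)} ->
    {in Q, forall x, r x <= r m} ->
    3 * L * \sum_(ij : I * J) h ((psi ij.1 \o y ij.2) \o r)
      <= 3 * L * \sum_(i : I) \sum_(j : J) H i (y j \o r) + #|I| * #|J| /\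
    3 * L * \sum_(i : I) \sum_(j : J) H i (y j \o r)
      <= 3 * L * \sum_(ij : I * J) h ((psi ij.1 \o y ij.2) \o r) + #|I| * #|J|.
  move=> r_lt r_lt_m r_le_m.
  rewrite -(pair_bigA _ (fun i j => nat_of_bool (h ((psi i \o y j) \o r)))) /=.
  have swap (F : I -> J -> nat) :
    \sum_i \sum_j F i j = \sum_j \sum_i F i j by apply: exchange_big.
  rewrite !swap [#|I| * _]mulnC.
  have step j : 3 * L * \sum_i h (psi i \o y j \o r)
      <= 3 * L * \sum_i H i (y j \o r) + #|I| /\
    3 * L * \sum_i H i (y j \o r)
      <= 3 * L * \sum_i h (psi i \o y j \o r) + #|I|.
    have y_mono : {mono y j : a b / a < b} by apply/leqW_mono/leq_mono/y_incr.
    pose g f := h (f \o (y j \o r)).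
    have g_ext f f' : f =1 f' -> g f = g f'.
      by move=> eq_f; apply: h_loc => x _ /=; rewrite eq_f.
    have E1 i : g (freeze (psi i) (y j (r m)) (psi i (y j (r m)))) = h (psi i \o y j \o r).
      apply: h_loc => x xQ; rewrite /freeze /=; case: ltnP => // ge_rm.
      congr psi; apply/eqP; rewrite eqn_leq ge_rm.
      by rewrite (leq_mono (y_incr j)) r_le_m.
    have E2 i : g (freeze (psi i) (y j (r m)) (psi i K)) = H i (y j \o r).
      by apply: h_loc => x xQ; rewrite /freeze /= y_mono r_lt_m // inE xQ.
    have := psi_close (y j (r m)) g (le_K j _ (r_lt m)) g_ext.
    rewrite (eq_bigr _ (fun i _ => congr1 nat_of_bool (E1 i))).
    by rewrite (eq_bigr _ (fun i _ => congr1 nat_of_bool (E2 i))).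
  by split; apply: leq_mul_sum => j; have [] := step j.
have q_lt_m : {in Q, forall x, (q x < q m) = (p x < p m)}.
  by move=> x xQ; rewrite pq_iso.
have q_le_m : {in Q, forall x, q x <= q m}.
  by move=> x xQ; rewrite leqNgt -pq_iso // -leqNgt m_max.
have [p_close _] := sum_close p p_lt (fun _ _ => erefl) m_max.
have [_ q_close] := sum_close q q_lt q_lt_m q_le_m.
have H_close i : 3 * L * \sum_j H i (y j \o p) <= 3 * L * \sum_j H i (y j \o q) + #|J|.
  apply: (y_close X Q') => //.
  by move=> x x'; rewrite !inE => /andP[xQ _] /andP[x'Q _]; apply: pq_iso.
have {H_close} : 3 * L * \sum_i \sum_j H i (y j \o p)
    <= 3 * L * \sum_i \sum_j H i (y j \o q) + #|I| * #|J|.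
  exact: leq_mul_sum.
move: p_close q_close; rewrite card_prod -!mulnA.
set Sp := \sum_i h _; set Sq := \sum_i h _.
by move: Sp Sq (\sum_i _) (\sum_i _) => Sp Sq Tp Tq; lia.
Qed.

(** * Flipping a bit inside a block *)

(** The bitwise exclusive or of [v] with [2 ^ b]. *)
Definition flip (b v : nat) : nat :=
  if odd (v %/ 2 ^ b) then v - 2 ^ b else v + 2 ^ b.

Definition flip0 (q : nat) : nat := if odd q then q.-1 else q.+1.

Lemma flipE (b v : nat) : flip b v = flip0 (v %/ 2 ^ b) * 2 ^ b + v %% 2 ^ b.
Proof.
rewrite /flip /flip0; have := divn_eq v (2 ^ b).
by case: (v %/ 2 ^ b) => [|q] /=; [lia | case: ifP => _; rewrite ?mulSn; lia].
Qed.

Lemma flip_div (b v : nat) : flip b v %/ 2 ^ b = flip0 (v %/ 2 ^ b).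
Proof. by rewrite flipE divnMDl ?expn_gt0 // (@divn_small (_ %% _)) ?addn0 ?ltn_pmod ?expn_gt0. Qed.

Lemma flip0K : involutive flip0.
Proof. by case=> [|q] //; rewrite /flip0 /=; case odd_q: (odd q); rewrite /= odd_q. Qed.

Lemma flip_mod (b v : nat) : flip b v %% 2 ^ b = v %% 2 ^ b.
Proof. by rewrite flipE modnMDl modn_mod. Qed.

Lemma flipK (b : nat) : involutive (flip b).
Proof. by move=> v; rewrite flipE flip_div flip_mod flip0K -divn_eq. Qed.

Lemma flip_div_high (b m v : nat) : b < m -> flip b v %/ 2 ^ m = v %/ 2 ^ m.
Proof.
move=> lt_bm; have -> : 2 ^ m = 2 ^ b * (2 * 2 ^ (m - b.+1)).
  by rewrite -expnS -expnD; congr (2 ^ _); lia.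
rewrite !divnMA flip_div; congr (_ %/ _).
case: (v %/ 2 ^ b) => // q; rewrite !divn2 /flip0 /= uphalf_half.
by case: (odd q).
Qed.

Lemma odd_flip (b v i : nat) :
  odd (flip b v %/ 2 ^ i) = odd (v %/ 2 ^ i) (+) (i == b).
Proof.
have [lt_ib|lt_bi|->] := ltngtP i b.
- have low w : odd (w %/ 2 ^ i) = odd (w %% 2 ^ b %/ 2 ^ i).
    have e : 2 ^ b = 2 ^ (b - i) * 2 ^ i by rewrite -expnD subnK // ltnW.
    rewrite {1}(divn_eq w (2 ^ b)) {2}e mulnA.
    by rewrite divnMDl ?expn_gt0 // oddD oddM oddX /= subn_eq0 leqNgt lt_ib andbF.
  by rewrite low flip_mod -low addbF.
- by rewrite flip_div_high // addbF.
- rewrite flip_div addbT /flip0; case: (v %/ 2 ^ b) => //= q.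
  by case odd_q: (odd q); rewrite /= odd_q.
Qed.

Lemma leq_mod_bits (v w k : nat) :
  (forall i, odd (v %/ 2 ^ i) -> odd (w %/ 2 ^ i)) -> v %% 2 ^ k <= w %% 2 ^ k.
Proof.
elim: k v w => [|k IHk] v w le_bits; first by rewrite !modn1.
have mod_half u : u %% 2 ^ k.+1 = odd u + (u %/ 2 %% 2 ^ k) * 2.
  rewrite -modn2 modn_divl -expnSr [LHS](divn_eq _ 2) addnC.
  by rewrite modn_dvdm // expnS dvdn_mulr.
rewrite !mod_half leq_add // ?leq_mul2r.
  by have := le_bits 0; rewrite !divn1; case: (odd v) => // ->.
by rewrite IHk // => i; rewrite -!divnMA -expnS; apply: le_bits.
Qed.

Definition block_flip (m B b v : nat) : nat :=
  if v %/ 2 ^ m == B then flip b v else v.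

Lemma block_flip_div (m B b v c : nat) : b < c -> block_flip m B b v %/ 2 ^ c = v %/ 2 ^ c.
Proof. by rewrite /block_flip => lt_bc; case: ifP => // _; rewrite flip_div_high. Qed.

Lemma ltn_divn_neq {c u v : nat} : u %/ c != v %/ c -> (u < v) = (u %/ c < v %/ c).
Proof.
move=> neq_q; apply/idP/idP => [/ltnW/(leq_div2r c)|].
  by rewrite leq_eqVlt (negbTE neq_q).
by rewrite !ltnNge; apply: contra; apply: leq_div2r.
Qed.

(** If the bits above [b] differ, they decide the order and do not move. If they agree, both values
    share a block: outside block [B] nothing moves, and inside it the hypothesis forces equal bits
    [b], so both values move by the same amount. *)
Lemma block_flip_order (m B b u v : nat) : b < m ->
  ~~ [&& u %/ 2 ^ m == B, u %/ 2 ^ b.+1 == v %/ 2 ^ b.+1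
       & u %/ 2 ^ b != v %/ 2 ^ b] ->
  (u < v) = (block_flip m B b u < block_flip m B b v).
Proof.
move=> lt_bm; have [eq_uv|neq_uv] /= := eqVneq (u %/ 2 ^ b.+1) (v %/ 2 ^ b.+1); last first.
  rewrite (@ltn_divn_neq (2 ^ b.+1)) //.
  by rewrite (@ltn_divn_neq (2 ^ b.+1) (block_flip _ _ _ _)) !block_flip_div.
have eq_m : u %/ 2 ^ m = v %/ 2 ^ m.
  by rewrite -(subnKC lt_bm) expnD !divnMA eq_uv.
rewrite /block_flip -eq_m; case: eqP => //= _; rewrite negbK => /eqP eq_b.
rewrite /flip eq_b; case: ifP => [odd_q|_]; last by rewrite ltn_add2r.
by rewrite ltn_sub2rE // -divn_gt0 ?expn_gt0 // eq_b odd_gt0.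
Qed.

Definition detects {X : finType} (T : {set X}) (v : X -> nat) (m B b : nat) : bool :=
  [exists x in T, exists y in T, [&& v y %/ 2 ^ m == B,
     v x %/ 2 ^ b.+1 == v y %/ 2 ^ b.+1 & v x %/ 2 ^ b < v y %/ 2 ^ b]].

Lemma undetected_order_iso {X : finType} (T : {set X}) (v : X -> nat) (m B b : nat) :
  b < m -> ~~ detects T v m B b ->
  order_iso T v (fun x => block_flip m B b (v x)).
Proof.
move=> lt_bm undet x y xT yT; apply: block_flip_order => //.
apply: contra undet => /and3P[/eqP block_x /eqP eq_hi].
have eq_m : v x %/ 2 ^ m = v y %/ 2 ^ m by rewrite -(subnKC lt_bm) expnD !divnMA eq_hi.
rewrite neq_ltn => /orP[] lt_q.
- apply/exists_inP; exists x => //; apply/exists_inP; exists y => //.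
  by rewrite -eq_m block_x eq_hi !eqxx.
- apply/exists_inP; exists y => //; apply/exists_inP; exists x => //.
  by rewrite block_x eq_hi !eqxx.
Qed.

(* A detected pair (B, b) is recovered from y, the least point of T sharing with the larger witness all bits from b up: B is its block and b the highest bit where it differs from a smaller point of T. *)
Lemma card_detected {X : finType} (T : {set X}) (v : X -> nat) (m C : nat) :
  #|[set e : 'I_C * 'I_m | detects T v m e.1 e.2]| <= #|T|.
Proof.
pose P (e : 'I_C * 'I_m) y := [&& y \in T, v y %/ 2 ^ m == e.1,
  [exists x in T, (v x %/ 2 ^ e.2.+1 == v y %/ 2 ^ e.2.+1) && (v x < v y)] &
  [forall z in T, (v z %/ 2 ^ e.2 == v y %/ 2 ^ e.2) ==> (v y <= v z)]].
have ex_P (e : 'I_C * 'I_m) : detects T v m e.1 e.2 -> exists y, P e y.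
  case/exists_inP=> x xT /exists_inP[y yT] /and3P[/eqP block_y /eqP eq_hi lt_q].
  pose same z := (z \in T) && (v z %/ 2 ^ e.2 == v y %/ 2 ^ e.2).
  have same_y : same y by rewrite /same yT eqxx.
  case: (arg_minnP v same_y) => z /andP[zT /eqP eq_z] z_min.
  exists z; apply/and4P; split=> //.
  - rewrite -block_y -(subnKC (ltnW (ltn_ord e.2))) expnD !divnMA eq_z //.
  - apply/exists_inP; exists x => //; rewrite eq_hi expnSr !divnMA eq_z eqxx /=.
    by rewrite ltnNge; apply: contraL lt_q => /(leq_div2r (2 ^ e.2)); rewrite eq_z -leqNgt.
  - apply/forall_inP => w wT; apply/implyP => /eqP eq_w.
    by apply: z_min; rewrite /same wT eq_w eq_z eqxx.
have [/eqP ->|] := boolP ([set e : 'I_C * 'I_m | detects T v m e.1 e.2] == finset.set0).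
  by rewrite cards0.
case/finset.set0Pn=> e0; rewrite inE => /ex_P[x0 _].
pose f e := if [pick y | P e y] is Some y then y else x0.
have fP (e : 'I_C * 'I_m) : detects T v m e.1 e.2 -> P e (f e).
  move/ex_P => [y Py]; rewrite /f; case: pickP => // noP.
  by have := noP y; rewrite Py.
rewrite -(card_in_imset (f := f)); last first.
  move=> e e'; rewrite !inE => /fP Pe /fP Pe' eq_f; rewrite -eq_f in Pe'.
  move: (f e) Pe Pe' => y {x0 f fP eq_f} Pe Pe'.
  wlog le_e : e e' Pe Pe' / e.2 <= e'.2.
    by case: (leqP e.2 e'.2) => [|/ltnW] le_e IH; [|symmetry]; apply: IH.
  case/and4P: Pe => yT /eqP By /exists_inP[x xT /andP[/eqP eq_x lt_x]] _.
  case/and4P: Pe' => _ /eqP By' _ /forall_inP y_min.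
  (* If [e.2 < e'.2], the smaller witness [x] for [e] agrees with [y] on all bits from [e'.2] up,
     against the minimality of [y] for [e']. *)
  have eq2 : e.2 = e'.2.
    apply/val_inj/eqP; rewrite eqn_leq le_e leqNgt; apply/negP => lt_e.
    have := y_min x xT; rewrite leqNgt lt_x implybF -(subnKC lt_e) expnD !divnMA.
    by rewrite eq_x eqxx.
  case: e e' By By' eq2 {eq_x lt_x x xT y_min le_e} => [e1 e2] [e1' e2'] /= By By' ->.
  by congr (_, _); apply/val_inj; rewrite /= -By -By'.
by apply/subset_leq_card/fintype.subsetP => y /imsetP[e]; rewrite inE => /fP/and4P[fT _ _ _] ->.
Qed.

(** * The grid *)

Definition rank_grid {n d : nat} (x : grid n d) : nat :=
  \sum_(i < d) tnth x i * n ^ i.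

Definition unrank_grid {n : nat} (d : nat) (n_gt0 : 0 < n) (v : nat) : grid n d :=
  [tuple Ordinal (ltn_pmod (v %/ n ^ i) n_gt0) | i < d].

Lemma rank_grid_le (n d : nat) (x y : grid n d) :
  (x <= y)%O -> rank_grid x <= rank_grid y.
Proof.
rewrite leEtprod => /forallP le_xy; apply: leq_sum => i _.
by rewrite leq_mul2r; have := le_xy i; rewrite leEord => ->; rewrite orbT.
Qed.

Lemma sum_digits (n d v : nat) :
  \sum_(i < d) (v %/ n ^ i %% n) * n ^ i = v %% n ^ d.
Proof.
elim: d => [|d IHd]; first by rewrite big_ord0 modn1.
rewrite big_ord_recr /= IHd modn_divl -expnS [RHS](divn_eq _ (n ^ d)) addnC.
by rewrite modn_dvdm // expnS dvdn_mull.
Qed.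

Lemma unrank_gridK (n d : nat) (n_gt0 : 0 < n) (v : nat) :
  v < n ^ d -> rank_grid (unrank_grid d n_gt0 v) = v.
Proof.
move=> lt_v; rewrite -[RHS](modn_small lt_v) -sum_digits.
by apply: eq_bigr => i _; rewrite tnth_mktuple.
Qed.

(** Unranking is injective on the numbers below [n ^ d], which are as many as the grid points, so
    its one-sided inverse is two-sided. *)
Lemma rank_gridK (n d : nat) (n_gt0 : 0 < n) :
  cancel (@rank_grid n d) (unrank_grid d n_gt0).
Proof.
pose u (v : 'I_(n ^ d)) := unrank_grid d n_gt0 v.
have u_inj : injective u.
  move=> v w eq_u; apply/val_inj.
  by rewrite /= -(unrank_gridK n d n_gt0 v) // -/(u v) eq_u unrank_gridK.
have card_le : #|{: grid n d}| <= #|'I_(n ^ d)| by rewrite card_tuple !card_ord.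
have [u' uK u'K] := inj_card_bij u_inj card_le.
by move=> x; rewrite -[in LHS](u'K x) unrank_gridK // -[RHS]u'K.
Qed.

Lemma rank_grid_lt (n d : nat) (x : grid n d) : 0 < n -> rank_grid x < n ^ d.
Proof.
move=> n_gt0; rewrite -[x](rank_gridK n d n_gt0) [X in X < _](_ : _ = rank_grid x %% n ^ d).
  by rewrite ltn_mod expn_gt0 n_gt0.
by rewrite -sum_digits; apply: eq_bigr => i _; rewrite tnth_mktuple.
Qed.

(** In base [2 ^ k] each coordinate is a run of [k] consecutive bits, so bitwise domination gives
    the coordinate-wise order. *)
Lemma unrank_grid_le (k d : nat) (n_gt0 : 0 < 2 ^ k) (v w : nat) :
  (forall i, odd (v %/ 2 ^ i) -> odd (w %/ 2 ^ i)) ->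
  (unrank_grid d n_gt0 v <= unrank_grid d n_gt0 w)%O.
Proof.
move=> le_bits; rewrite leEtprod; apply/forallP => i.
rewrite leEord !tnth_mktuple /= -expnM; apply: leq_mod_bits => j.
by rewrite -!divnMA -expnD; apply: le_bits.
Qed.

(* Flipping bit b pairs up the points of the block into violated pairs, each of which meets the set where the function and g differ. *)
Lemma block_flip_far {k d m B b : nat} {phi : nat -> nat} {g : grid (2 ^ k) d -> nat} :
  b < m -> m <= k * d -> B < 2 ^ (k * d - m) ->
  {homo phi : i j / i < j} -> Defs.monotone g ->
  2 ^ m <= 2 * #|[set x | phi (block_flip m B b (rank_grid x)) != g x]%SET|.
Proof.
move=> lt_bm le_m lt_B phi_incr g_mono.
have n_gt0 : 0 < 2 ^ k by rewrite expn_gt0.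
pose rank := @rank_grid (2 ^ k) d; pose unrank := unrank_grid d n_gt0.
have rankK : cancel rank unrank by apply: rank_gridK.
have unrankK v : v < 2 ^ (k * d) -> rank (unrank v) = v.
  by rewrite expnM; apply: unrank_gridK.
have rank_lt x : rank x < 2 ^ (k * d) by rewrite expnM; apply: rank_grid_lt.
set D := [set x | _]%SET; pose F x := unrank (flip b (rank x)).
have rankF x : rank (F x) = flip b (rank x).
  (* The rank stays in range because the flip keeps its quotient by [2 ^ (k * d)], which is 0. *)
  apply: unrankK; have := rank_lt x; rewrite -[X in _ < X]mul1n -[X in _ -> _ < X]mul1n.
  by rewrite -!ltn_divLR ?expn_gt0 // flip_div_high // (leq_trans lt_bm).
have FK : involutive F by move=> x; rewrite /F -/(F x) rankF flipK rankK.
pose block := [set x | rank x %/ 2 ^ m == B]%SET.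
have F_block x : x \in block -> F x \in block by rewrite !inE rankF flip_div_high.
have low_bit x : x \in block -> ~~ odd (rank x %/ 2 ^ b) -> (x \in D) || (F x \in D).
  move=> x_block bit0; apply: contraT; rewrite negb_or !inE !negbK => /andP[/eqP eq_x /eqP eq_Fx].
  have : g x <= g (F x).
    rewrite -[x in g x]rankK; apply/g_mono/unrank_grid_le => i odd_i.
    by rewrite odd_flip odd_i; case: eqP odd_i => // ->; rewrite (negbTE bit0).
  rewrite -eq_x -eq_Fx -/rank rankF leqNgt phi_incr //.
  have := F_block x x_block; move: x_block; rewrite !inE rankF /block_flip => -> ->.
  by rewrite flipK /flip (negbTE bit0) -ltn_subLR // subnn expn_gt0.
have block_sub : block \subset D :|: F @: D.
  apply/fintype.subsetP => x x_block; rewrite inE -{2}[x]FK (mem_imset _ _ (inv_inj FK)).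
  have [bit1|bit0] := boolP (odd (rank x %/ 2 ^ b)); last exact: low_bit.
  rewrite orbC -{2}[x]FK low_bit ?F_block //.
  by rewrite rankF odd_flip bit1 eqxx.
have card_block : 2 ^ m <= #|block|.
  pose u (w : 'I_(2 ^ m)) := unrank (B * 2 ^ m + w).
  have rank_u w : rank (u w) = B * 2 ^ m + w.
    apply: unrankK; rewrite -(subnK le_m) expnD.
    by apply: leq_trans (leq_mul lt_B (leqnn (2 ^ m))); rewrite mulSn addnC ltn_add2r.
  rewrite -[X in X <= _]card_ord -(card_imset (f := u)); last first.
    move=> w w' eq_u; apply/val_inj/eqP.
    by rewrite -(eqn_add2l (B * 2 ^ m)) -!rank_u eq_u.
  apply/subset_leq_card/fintype.subsetP => _ /imsetP[w _ ->].
  by rewrite inE rank_u divnMDl ?expn_gt0 // divn_small // addn0.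
apply: leq_trans card_block _; apply: leq_trans (subset_leq_card block_sub) _.
by rewrite mul2n -addnn (leq_trans (leq_card_setU _ _)) // leq_add2l leq_imset_card.
Qed.

(** * Query algorithms *)

Fixpoint queried {X : finType} (a : query_algo X) (f : X -> nat) : {set X} :=
  if a is Query x next then x |: queried (next (f x)) f else finset.set0.

Lemma card_queried {X : finType} (a : query_algo X) (f : X -> nat) :
  #|queried a f| <= num_queries a f.
Proof.
elim: a => [b|x next IH] /=; first by rewrite cards0.
by rewrite (leq_trans (leq_card_setU _ _)) // cards1 ltnS.
Qed.

Lemma queried_local {X : finType} (a : query_algo X) (f g : X -> nat) :
  {in queried a f, f =1 g} ->
  queried a g = queried a f /\ accepts a g = accepts a f.
Proof.
elim: a => [b|x next IH] //= eq_fg.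
rewrite -eq_fg ?setU11 //; have [|-> ->] // := IH (f x).
by move=> y y_in; apply: eq_fg; rewrite !inE y_in orbT.
Qed.

(** Split acceptance according to the query set [Q]. For a fixed good [Q] the event is local on [Q]
    and changes by at most [1 / (4 * 2 ^ #|X|)]; over all [2 ^ #|X|] sets this adds up to [1 / 4].
    Bad sets are charged to the [bad] term. *)
Lemma acceptance_close {X I : finType} {phi : I -> nat -> nat} {t N : nat}
    (a : query_algo X) (p q : X -> nat) (bad : {set X} -> bool) :
  spread phi t N (4 * 2 ^ #|X|) ->
  (forall f, num_queries a f <= t) ->
  (forall x, p x < N) -> (forall x, q x < N) ->
  (forall Q, ~~ bad Q -> order_iso Q p q) ->
  4 * \sum_i accepts a (phi i \o p)
    <= 4 * \sum_i (accepts a (phi i \o q) + bad (queried a (phi i \o p))) + #|I|.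
Proof.
move=> phi_close a_le p_lt q_lt good.
pose h Q f := (queried a f == Q) && accepts a f.
have h_loc Q : local_on Q (h Q).
  have half f g : {in Q, f =1 g} -> h Q f -> h Q g.
    move=> eq_fg /andP[/eqP eq_Q acc]; have [|eq1 eq2] := queried_local a f g.
      by rewrite eq_Q.
    by rewrite /h eq1 eq2 eq_Q eqxx.
  by move=> f g eq_fg; apply/idP/idP; apply: half => // x xQ; rewrite eq_fg.
have sum_eq (A : {set X} -> bool) f :
    \sum_Q (queried a f == Q) && A Q = A (queried a f) :> nat.
  rewrite (bigD1 (queried a f)) //= eqxx big1 ?addn0 // => Q.
  by rewrite eq_sym => /negbTE ->.
have sum_h f : accepts a f = \sum_Q h Q f :> nat by rewrite (sum_eq (fun=> accepts a f)).
have step Q : 4 * 2 ^ #|X| * \sum_i h Q (phi i \o p) <= 4 * 2 ^ #|X| *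
    \sum_i (h Q (phi i \o q) + ((queried a (phi i \o p) == Q) && bad Q)) + #|I|.
  have [bad_Q|good_Q] := boolP (bad Q).
    rewrite (leq_trans _ (leq_addr _ _)) // leq_mul2l leq_sum ?orbT // => i _.
    by rewrite (leq_trans _ (leq_addl _ _)) // /h; case: (_ == _); case: accepts.
  rewrite big_split /= [X in _ * (_ + X)]big1 ?addn0 => [|i _]; last by rewrite andbF.
  have [le_Q|gt_Q] := leqP #|Q| t; first exact: phi_close le_Q p_lt q_lt (good Q good_Q) (h_loc Q).
  rewrite big1 ?muln0 // => i _; rewrite /h; case: eqP => // eq_Q.
  by have := leq_trans (card_queried a (phi i \o p)) (a_le _); rewrite eq_Q leqNgt gt_Q.
have := leq_mul_sum step.
rewrite -[#|{set X}|]cardsT -powersetT card_powerset cardsT.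
rewrite exchange_big [X in _ <= _ * X + _ -> _]exchange_big /=.
under eq_bigr do rewrite -sum_h.
under [X in _ <= _ * X + _ -> _]eq_bigr do rewrite big_split /= -sum_h sum_eq.
by rewrite [4 * 2 ^ _]mulnC -!mulnA -mulnDr leq_pmul2l ?expn_gt0.
Qed.

(** For each pair [e], accepting the rank and rejecting its flipped version have total frequency at
    most [1 + 1 / 4] plus that of detecting [e]. A single run detects at most [t] pairs. *)
Lemma total_success_le {X I : finType} {phi : I -> nat -> nat} {t N m C : nat}
    {a : query_algo X} {v : X -> nat} :
  spread phi t N (4 * 2 ^ #|X|) ->
  (forall f, num_queries a f <= t) ->
  (forall x, v x < N) ->
  (forall (e : 'I_C * 'I_m) x, block_flip m e.1 e.2 (v x) < N) ->
  4 * \sum_(e : 'I_C * 'I_m) \sum_i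
      (accepts a (phi i \o v) + ~~ accepts a (phi i \o (block_flip m e.1 e.2 \o v)))
    <= #|I| * (5 * (C * m) + 4 * t).
Proof.
move=> phi_close a_le v_lt bv_lt.
pose bad (e : 'I_C * 'I_m) Q := detects Q v m e.1 e.2.
have step (e : 'I_C * 'I_m) : 4 * \sum_i
      (accepts a (phi i \o v) + ~~ accepts a (phi i \o (block_flip m e.1 e.2 \o v)))
    <= 4 * \sum_i bad e (queried a (phi i \o v)) + 5 * #|I|.
  have := acceptance_close a v (block_flip m e.1 e.2 \o v) (bad e)
    phi_close a_le v_lt (bv_lt e) (fun Q => undetected_order_iso Q v m e.1 e.2 (ltn_ord e.2)).
  have : \sum_i (accepts a (phi i \o (block_flip m e.1 e.2 \o v))
     + ~~ accepts a (phi i \o (block_flip m e.1 e.2 \o v))) = #|I|.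
    by rewrite -sum1_card; apply: eq_bigr => i _; case: accepts.
  by rewrite !big_split /=; lia.
have := leq_mul_sum step; rewrite card_prod !card_ord => le1.
apply: leq_trans le1 _; rewrite exchange_big /=.
have le2 : \sum_i \sum_e bad e (queried a (phi i \o v)) <= #|I| * t.
  rewrite -sum_nat_const; apply: leq_sum => i _.
  apply: leq_trans (leq_trans (card_queried a (phi i \o v)) (a_le _)).
  apply: leq_trans (card_detected _ v m C).
  by rewrite -sum1_card [leqRHS]big_mkcond; apply: leq_sum => e _; rewrite inE.
apply: leq_trans (leq_add (leq_mul (leqnn 4) le2) (leqnn _)) _.
by move: #|I| => c; lia.
Qed.

(** * Averaging over the coins of the tester *)

Local Open Scope classical_set_scope.
Local Open Scope ring_scope.

(** The sum of the probabilities is the integral of the number of events that occur, which is at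
    most [C] everywhere. *)
Lemma card_mul_prob_le {R : realType} {disp : measure_display}
    {Omega : measurableType disp} {P : probability Omega R} {J : finType}
    {E : J -> set Omega} {c C : R} :
  (forall j, measurable (E j)) -> (forall j, (c%:E <= P (E j))%E) ->
  (forall w, \sum_j \1_(E j) w <= C) ->
  #|J|%:R * c <= C.
Proof.
move=> mE cE sumE.
have m_indic j : measurable_fun setT (EFin \o (\1_(E j) : Omega -> R)).
  exact/measurable_EFinP/measurable_indic.
have sum_indicE : (\sum_j P (E j) = \int[P]_w (\sum_j (\1_(E j) w)%:E))%E.
  rewrite ge0_integral_sum //.
  by apply: eq_bigr => j _; rewrite integral_indic // setIT.
have sum_le : (\sum_j P (E j) <= C%:E)%E.
  rewrite sum_indicE -[leRHS]mule1 -(@probability_setT _ _ _ P) -integral_cst //.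
  apply: ge0_le_integral => //.
  - by move=> w _; apply: sume_ge0 => j _; rewrite lee_fin.
  - exact: emeasurable_sum.
  - by move=> w _; rewrite sumEFin lee_fin.
rewrite -lee_fin; apply: le_trans sum_le.
rewrite mulr_natl -sumr_const -sumEFin.
exact: lee_sum.
Qed.

(** With [M = 2 ^ j * m], the [2 * M * #|I|] required successes have probability at least [15 / 16]
    each, so [15 / 8 * M <= 5 / 4 * M + t]. *)
Lemma tester_query_count {R : realType} {k d m j t : nat}
    {disp : measure_display} {Omega : measurableType disp}
    {P : probability Omega R} {A : Omega -> query_algo (grid (2 ^ k) d)} :
  (k * d = j + m)%N ->
  monotonicity_tester P t ((1 / 2) ^+ j / 2) (1 / 16) A ->
  (5 * (2 ^ j * m) <= 8 * t)%N.
Proof.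
move=> kdE tester.
have n_gt0 : (0 < 2 ^ k)%N by rewrite expn_gt0.
pose v := @rank_grid (2 ^ k) d.
pose bf (e : 'I_(2 ^ j) * 'I_m) x := block_flip m e.1 e.2 (v x).
pose N := (2 ^ (k * d))%N.
have v_lt x : (v x < N)%N by rewrite /N expnM; apply: rank_grid_lt.
have bf_lt e x : (bf e x < N)%N.
  rewrite -[X in (_ < X)%N]mul1n -ltn_divLR ?expn_gt0 // block_flip_div.
    by rewrite ltn_divLR ?expn_gt0 // mul1n.
  by rewrite kdE; apply: leq_trans (ltn_ord e.2) (leq_addl _ _).
have [I [phi [I_gt0 phi_incr phi_close]]] :=
  spreadable_family t N (4 * 2 ^ #|{: grid (2 ^ k) d}|).
(* The acceptance event is repeated for every pair, so that each rejection event is matched with one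
   acceptance event. *)
pose E (z : ('I_(2 ^ j) * 'I_m) * I * bool) :=
  if z.2 then [set w | accepts (A w) (phi z.1.2 \o v)]
  else [set w | ~~ accepts (A w) (phi z.1.2 \o bf z.1.1)].
have measE z : measurable (E z).
  case: z => [[e i] [|]]; rewrite /E /=; first by have [] := tester (phi i \o v).
  rewrite [X in measurable X](_ : _ = ~` [set w | accepts (A w) (phi i \o bf e)]).
    by apply: measurableC; have [] := tester (phi i \o bf e).
  by apply/seteqP; split=> w /=; [move/negP | move/negP].
have probE z : (((1 - 1 / 16)%:E : \bar R) <= P (E z))%E.
  apply/ltW; case: z => [[e i] [|]]; rewrite /E /=.
    have [_ _ acc _] := tester (phi i \o v); apply: acc => x y le_xy /=.
    by rewrite leq_mono //; apply: rank_grid_le.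
  have [_ _ _ rej] := tester (phi i \o bf e); apply: rej => g g_mono.
  (* The grid has [2 ^ (j + m)] points, and the fraction [(1 / 2) ^+ j / 2] of them is half of
     [2 ^ m], which is the bound obtained here. *)
  have := block_flip_far (B := e.1) (ltn_ord e.2) _ _ (phi_incr i) g_mono.
  rewrite kdE leq_addl addnK ltn_ord => /(_ isT isT).
  rewrite card_tuple card_ord -expnM kdE -(ler_nat R) natrM !natrX exprD.
  have half : (1 / 2 : R) ^+ j * 2 ^+ j = 1 by rewrite -exprMn div1r mulVf ?expr1n.
  rewrite mulrAC !mulrA half mul1r ler_pdivrMr // [X in _ -> _ <= X]mulrC.
  exact.
have sumE w : \sum_z \1_(E z) w <= (#|I| * (5 * (2 ^ j * m) + 4 * t))%:R / 4 :> R.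
  have := total_success_le phi_close
    (fun f => let: And4 _ q _ _ := tester f in q w) v_lt bf_lt.
  rewrite -(ler_nat R) natrM => le_4.
  rewrite ler_pdivlMr // mulrC; apply: le_trans le_4; rewrite ler_pM2l //.
  rewrite pair_bigA /= natr_sum -(pair_bigA _ (fun ei b => \1_(E (ei, b)) w)) /=.
  apply: ler_sum => -[e i] _; rewrite big_bool /= natrD !indicE /E /=.
  have in_set (b : Omega -> bool) : (w \in [set w' | b w']) = b w.
    by apply/idP/idP; rewrite inE.
  by rewrite !in_set.
have := card_mul_prob_le measE probE sumE.
rewrite !card_prod !card_ord card_bool => le1.
rewrite -(ler_nat R).
have I_gt0R : 0 < #|I|%:R :> R by rewrite ltr0n.
move: le1; rewrite !natrM !natrD !natrM.
move: (2 ^ j)%:R m%:R t%:R #|I|%:R I_gt0R => a b c i i_gt0 le1.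
by rewrite -(ler_pM2l i_gt0); nra.
Qed.

Theorem theorem4 (R : realType) (n d t : nat) (eps : R)
    (disp : measure_display) (Omega : measurableType disp)
    (P : probability Omega R) (A : Omega -> query_algo (grid n d)) :
  (exists k : nat, n = (2 ^ k)%N) ->
  (0 < d)%N ->
  (exists j : nat, eps = (1 / 2) ^+ j) ->
  eps <= 1 / 2 ->
  log2 (1 / eps) <= d%:R * log2 n%:R ->
  monotonicity_tester P t (eps / 2) (1 / 16) A ->
  (d%:R * log2 n%:R - log2 (1 / eps)) / (8 * eps) <= t%:R.
Proof.
move=> [k nE] _ [j epsE] _; subst n.
have log2X (i : nat) : log2 (2 ^+ i : R) = i%:R.
  rewrite /log2 lnXn // mulrnAl divff //.
  by rewrite gt_eqF // ln_gt0 // ltr1n.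
have eps_inv : 1 / eps = 2 ^+ j by rewrite epsE div1r -exprVn div1r invrK.
rewrite natrX eps_inv !log2X -natrM ler_nat => le_j tester.
have kdE : (k * d = j + (k * d - j))%N by rewrite subnKC // mulnC.
rewrite epsE in tester.
have := tester_query_count kdE tester.
have le_j' : (j <= k * d)%N by rewrite mulnC.
rewrite -(ler_nat R) !natrM natrX natrB // natrM => le_t.
rewrite invfM -[eps^-1]div1r eps_inv -natrM; move: le_t.
rewrite [(d * k)%N]mulnC natrM.
(* The count is five times stronger than required; the factor is dropped because this product is
   nonnegative. *)
have : 0 <= 2 ^+ j * (k%:R * d%:R - j%:R) :> R.
  by rewrite mulr_ge0 ?exprn_ge0 // subr_ge0 -natrM ler_nat.
by move: (2 ^+ j) (k%:R * d%:R - j%:R) => x y; lra.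
Qed.
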